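(* Let $k,t$ be integers with $2\le t\le 2k-1$ and let $e=k(k-1)+t$. If $k>4t^4+4$, then $\rho(e)=\rho(D^{\#})$. Moreover, if $D\in\mathcal{D}(e)$ satisfies $\rho(D)=\rho(e)$, then apart from isolated vertices $D=D^{\#}$. In other words, for any $D\in\mathcal{D}(e)$ one has $\rho(D)\le\rho(D^{\#})$, with equality if and only if, apart from isolated vertices, $D=D^{\#}$.
   Context: A simple digraph is a finite directed graph with no loops and no multiple arcs (a pair of opposite arcs $(u,v),(v,u)$ is allowed). The adjacency matrix $A(D)=(a_{ij})$ has $a_{ij}=1$ if there is an arc from $v_i$ to $v_j$ and $a_{ij}=0$ otherwise. The spectral radius $\rho(D)$ is the eigenvalue of $A(D)$ of largest modulus (a nonnegative real number, by Perron-Frobenius). $\mathcal{D}(e)$ is the set of all simple digraphs with exactly $e$ arcs (on any number of vertices), and $\rho(e)=\max\{\rho(D): D\in\mathcal{D}(e)\}$. $\overleftrightarrow{K_k}$ is the complete simple digraph on $k$ vertices: all $k(k-1)$ arcs $(u,v)$ with $u\ne v$. For $e=k(k-1)+t$ with $0\le t\le 2k-1$, $D^{\#}$ denotes a simple digraph of order $k+1$ obtained from $\overleftrightarrow{K_k}$ by adding a new vertex $v$, arcs in both directions between $v$ and $\lfloor t/2\rfloor$ vertices of $\overleftrightarrow{K_k}$, and, if $t$ is odd, one further arc, in either direction, between $v$ and one additional vertex of $\overleftrightarrow{K_k}$. For odd $t$ the two choices of direction give digraphs that are the reverses of each other and have the same spectral radius; ''$D=D^{\#}$'' means that $D$ is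 isomorphic to one of the digraphs so described. An isolated vertex is one with no incoming and no outgoing arcs. ''Apart from isolated vertices, $D=H$'' means that $D$ and $H$ become isomorphic after all isolated vertices are deleted from both. *)

(* Defs.v *)
From mathcomp Require Import all_boot all_order all_algebra.
From mathcomp Require Import complex.
From mathcomp Require Import boolp classical_sets reals.

Set Implicit Arguments.
Unset Strict Implicit.
Unset Printing Implicit Defensive.

Import Order.TTheory GRing.Theory Num.Theory ComplexField.Normc.

Record digraph := Digraph {
  vertex :> finType;
  arc : rel vertex;
  arc_irreflexive : irreflexive arc }.

Definition num_arcs (D : digraph) : nat :=
  #|[set p : D * D | arc p.1 p.2]|.

Definition digraph_iso (D H : digraph) : Prop :=
  exists f : D -> H, bijective f /\ forall x y, arc (f x) (f y) = arc x y.

Definition isolated (D : digraph) (x : D) : bool :=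
  [forall y, ~~ arc x y && ~~ arc y x].

Definition delete_isolated (D : digraph) : digraph :=
  @Digraph {x : D | ~~ isolated x} (fun x y => arc (val x) (val y))
    (fun x => arc_irreflexive (val x)).

Definition iso_up_to_isolated (D H : digraph) : Prop :=
  digraph_iso (delete_isolated D) (delete_isolated H).

(* The vertex [ord_max] is the added vertex v and the vertices 0, ..., k-1 are
   those of the complete digraph.  Arcs join v in both directions to the first
   [t./2] vertices; since [uphalf t = t./2 + odd t], when [t] is odd there is
   one further arc, joining v and the vertex [t./2]: it points towards v if
   [into] is true and away from v otherwise.  When [t] is even, [into] is
   irrelevant. *)
Definition Dsharp_arc (k t : nat) (into : bool) : rel 'I_k.+1 :=
  fun i j =>
    if (i < k) && (j < k) then i != j
    else if i < k then i < (if into then uphalf t else t./2)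
    else if j < k then j < (if into then t./2 else uphalf t)
    else false.

Lemma Dsharp_arc_irreflexive k t into : irreflexive (@Dsharp_arc k t into).
Proof. by move=> i; rewrite /Dsharp_arc eqxx; case: (i < k). Qed.

Definition Dsharp (k t : nat) (into : bool) : digraph :=
  Digraph (@Dsharp_arc_irreflexive k t into).

Lemma num_arcs_Dsharp k t into :
  t <= 2 * k - 1 -> num_arcs (Dsharp k t into) = k * (k - 1) + t.
Proof.
move=> tk.
have hk : uphalf t <= k by rewrite leq_uphalf_double -mul2n; apply: leq_trans tk (leq_subr _ _).
have hk' : t./2 <= k by apply: leq_trans hk; rewrite uphalf_half leq_addl.
have cnt m : m <= k -> \sum_(i < k) (i < m : nat) = m.
  move=> mk; rewrite -[RHS]card_ord -sum1_card -(big_mkord xpredT (fun=> 1)).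
  by rewrite (big_nat_widen _ _ k) // big_mkord [RHS]big_mkcond.
have -> : num_arcs (Dsharp k t into)
    = \sum_(i < k.+1) \sum_(j < k.+1) Dsharp_arc t into i j.
  rewrite pair_big /= /num_arcs -sum1_card big_mkcond /=.
  by apply: eq_bigr => -[i j] _; rewrite inE /=; case: Dsharp_arc.
rewrite big_ord_recr /= [X in _ + X]big_ord_recr /=.
rewrite {3}/Dsharp_arc /= ltnn /= addn0.
under eq_bigr => i _ do rewrite big_ord_recr /=.
rewrite big_split /=.
have -> : \sum_(i < k) \sum_(j < k)
    Dsharp_arc t into (widen_ord (leqnSn k) i) (widen_ord (leqnSn k) j)
    = k * (k - 1).
  rewrite -[X in X * _]card_ord -sum_nat_const; apply: eq_bigr => i _.
  under eq_bigr => j _ do rewrite /Dsharp_arc /= !ltn_ord /=.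
  have -> : k - 1 = #|predC1 i| by rewrite cardC1 card_ord subn1.
  rewrite -sum1_card [RHS]big_mkcond /=.
  by apply: eq_bigr => j _; rewrite !inE -!val_eqE /= eq_sym; case: eqP.
under eq_bigr => i _ do rewrite /Dsharp_arc /= ltnn andbF ltn_ord.
under [X in _ + X]eq_bigr => i _ do rewrite /Dsharp_arc /= ltnn /= ltn_ord.
rewrite -addnA; congr (_ + _).
case: into; rewrite !cnt // uphalf_half.
  by rewrite -addnA addnn odd_double_half.
by rewrite addnCA addnn odd_double_half.
Qed.

Local Open Scope ring_scope.
Local Open Scope complex_scope.
Local Open Scope classical_set_scope.

Definition adjacency (F : nzRingType) (D : digraph) : 'M[F]_#|D| :=
  \matrix_(i, j) (arc (enum_val i) (enum_val j))%:R.

(* The supremum is attained as soon as D has a vertex, see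
   [spectral_radius_max]; the value is 0 for the digraph without vertices. *)
Definition spectral_radius (R : realType) (D : digraph) : R :=
  sup [set normc z | z in [set z : R[i] | eigenvalue (adjacency _ D) z]].

Lemma spectral_radius_max (R : realType) (D : digraph) : (0 < #|D|)%N ->
  exists2 z : R[i], eigenvalue (adjacency _ D) z &
    `|z| = (spectral_radius R D)%:C /\
    forall w : R[i], eigenvalue (adjacency _ D) w -> `|w| <= `|z|.
Proof.
move=> D_gt0; set A := adjacency _ D.
have [rs rsE] := closed_field_poly_normal (char_poly A).
have {}rsE w : eigenvalue A w = (w \in rs).
  rewrite eigenvalue_root_char rsE (monicP (char_poly_monic A)) scale1r.
  by rewrite root_prod_XsubC.
have [x xrs] : exists x, x \in rs.
  have [|x Ax] := closed_rootP (char_poly A) _.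
    by rewrite size_char_poly; case: #|D| D_gt0.
  by exists x; rewrite -rsE eigenvalue_root_char.
have [z zrs zmax] : exists2 z, z \in rs & forall w, w \in rs -> normc w <= normc z.
  elim: rs x xrs {rsE} => // y rs IHrs _ _.
  have [->|[x xrs]] : rs = [::] \/ exists x, x \in rs.
  - by case: rs {IHrs} => [|x rs]; [left | right; exists x; rewrite mem_head].
  - by exists y => [|w]; rewrite !inE // => /eqP->.
  have [z zrs zmax] := IHrs x xrs.
  have [yz|/ltW zy] := leP (normc y) (normc z).
  - exists z => [|w]; rewrite inE ?zrs ?orbT //.
    by case/predU1P=> [->//|/zmax].
  exists y => [|w]; rewrite inE ?eqxx //.
  by case/predU1P=> [->//|/zmax/le_trans]; apply.
exists z; first by rewrite rsE.
split=> [|w]; last by rewrite rsE => /zmax; rewrite -lecR.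
congr _%:C; apply/le_anti/andP; split.
  apply: ub_le_sup; last by exists z => //=; rewrite rsE.
  by exists (normc z) => _ [w /=+ <-]; rewrite rsE; apply: zmax.
apply: ge_sup; first by exists (normc z), z => //=; rewrite rsE.
by move=> _ [w /=+ <-]; rewrite rsE; apply: zmax.
Qed.

(* The digraphs range over all finite vertex types.  Isolated vertices do not
   change the spectral radius, so it takes finitely many values on digraphs with
   [e] arcs and this supremum is a maximum. *)
Definition max_spectral_radius (R : realType) (e : nat) : R :=
  sup [set r | exists2 D : digraph, num_arcs D = e & spectral_radius R D = r].

(* Main.v *)
From mathcomp Require Import all_boot all_order all_algebra.
From mathcomp Require Import complex.
From mathcomp Require Import reals.
From mathcomp Require Import ring lra zify.
Require Import Defs.

Set Implicit Arguments.
Unset Strict Implicit.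
Unset Printing Implicit Defensive.

Import Order.TTheory GRing.Theory Num.Theory.
Local Open Scope ring_scope.

(** Let [D] have [k * (k - 1) + t] arcs and spectral radius [r]. The moduli of the
    coordinates of an eigenvector give weights [x], at most 1 and equal to 1 at some
    vertex [u], with [r * x j] at most the sum of [x i] over the arcs from [i] to [j]
    ([spectral_radius_subvector]). The proof shows that such weights with
    [r >= rho] exist only if [D] is the expected digraph and [r = rho], where [rho]
    is the root above [k - 1] of
    [(rho - k + 1) * (rho * (rho + 1) - t./2) = t./2 * uphalf t].
    This equation makes [rho] an eigenvalue of the extremal digraphs
    ([Dsharp_eigenvector]), so all parts of the theorem follow.

    The number of arcs leaves almost no room above [(k - 1) ^ 2]. Counting walks of
    length 2 ending at [u] shows that the arcs into the in-neighbours of [u] nearly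
    all start at vertices of weight almost 1. The vertices that feed many of these
    in-neighbours form a set of exactly [k] vertices: fewer could not sustain a
    growth rate above [k - 1], more would require too many arcs. An arc missing
    inside this set costs a constant, whereas arcs outside it gain only on the order
    of [t ^ 2 / k], so the set is a complete digraph ([exists_heavy_clique]).

    There remain [t] arcs outside the clique. If the outer vertex [w] receives
    [p w] arcs from the clique and sends [q w] arcs back, then [r - k + 1] is about
    [(\sum_w p w * q w) / k ^ 2]. Under the constraint that at most [t] arcs are
    used, this sum reaches [t./2 * uphalf t] only if one vertex carries all arcs,
    split as evenly as possible ([concentration]); every other distribution loses
    at least 1, more than the error terms. For a single vertex the inequalities can
    be solved exactly and decide the next term: the in- and out-neighbours of that
    vertex must overlap as much as possible ([rigidity]). *)

(** * Counting arcs *)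

Section Arcs.
Context {V : finType} (a : rel V).
Implicit Types P Q S : {set V}.

Definition outdeg (j : V) Q : nat := (\sum_(i in Q) a j i)%N.
Definition arcs P Q : nat := (\sum_(j in P) outdeg j Q)%N.

Lemma outdeg_setC j S : outdeg j setT = (outdeg j S + outdeg j (~: S))%N.
Proof.
rewrite /outdeg (bigID (mem S)) /=.
by congr addn; apply: eq_bigl => i; rewrite !inE.
Qed.

Lemma arcs_setCl S Q : arcs setT Q = (arcs S Q + arcs (~: S) Q)%N.
Proof.
rewrite /arcs (bigID (mem S)) /=.
by congr addn; apply: eq_bigl => i; rewrite !inE.
Qed.

Lemma arcs_setCr P S : arcs P setT = (arcs P S + arcs P (~: S))%N.
Proof. by rewrite -big_split; apply: eq_bigr => j _; apply: outdeg_setC. Qed.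

Lemma arcs_exchange P Q : arcs P Q = (\sum_(i in Q) \sum_(j in P) a j i)%N.
Proof. exact: exchange_big. Qed.

Definition missing S j : nat := (\sum_(i in S :\ j) ~~ a j i)%N.

Lemma outdeg_missing S j : irreflexive a -> j \in S -> (outdeg j S + missing S j = #|S|.-1)%N.
Proof.
move=> a_irr jS; rewrite /outdeg (big_setD1 j jS) /= a_irr add0n -big_split /=.
rewrite (cardsD1 j S) jS /= -sum1_card; apply: eq_bigr => i _; by case: (a j i).
Qed.
End Arcs.
Arguments arcs {V} a P Q. Arguments outdeg {V} a j Q.

Section Flow.
Context {R : realFieldType} {V : finType} (a : rel V) (x : V -> R).
Implicit Types P Q S : {set V}.
Definition flow P Q : R := \sum_(j in P) x j * (outdeg a j Q)%:R.

Lemma flow_setCl S Q : flow setT Q = flow S Q + flow (~: S) Q.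
Proof.
rewrite /flow (bigID (mem S)) /=.
by congr (_ + _); apply: eq_bigl => i; rewrite !inE.
Qed.

Context (x01 : forall j, 0 <= x j <= 1).

Lemma flow_le_arcs P Q : flow P Q <= (arcs a P Q)%:R.
Proof.
rewrite /flow natr_sum; apply: ler_sum => j _.
by rewrite ler_piMl ?ler0n //; case/andP: (x01 j).
Qed.

Context (r : R) (x_sub : forall j, r * x j <= \sum_i x i * (a i j)%:R).

(** Summed over a set, the inequality satisfied by [x] compares total weights with
    numbers of arcs between sets. *)
Lemma sub_flow Q : r * \sum_(i in Q) x i <= flow setT Q.
Proof.
rewrite mulr_sumr; apply: le_trans (ler_sum _ (fun j _ => x_sub j)) _.
rewrite exchange_big /= /flow le_eqVlt; apply/orP; left; apply/eqP.
rewrite [RHS](eq_bigl xpredT) => [|j]; last by rewrite inE.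
by apply: eq_bigr => j _; rewrite /outdeg natr_sum mulr_sumr.
Qed.

Lemma sum_ge0 P : 0 <= \sum_(i in P) x i.
Proof. by apply: sumr_ge0 => i _; case/andP: (x01 i). Qed.

Lemma sum_le_card P : \sum_(i in P) x i <= #|P|%:R.
Proof.
rewrite -sum1_card natr_sum; apply: ler_sum => i _.
by case/andP: (x01 i).
Qed.
End Flow.

(** The form in which the estimates use that [k] is large compared with [t]. *)
Lemma size_bounds (R : realFieldType) (k t : nat) :
  (2 <= t)%N -> (16 * t ^ 2 < k)%N ->
  [/\ 2 <= t%:R :> R, 16 * t%:R ^+ 2 + 1 <= k%:R :> R & 32 * t%:R + 1 <= k%:R :> R].
Proof.
move=> t_ge2 k_gt; have T2 : 2 <= t%:R :> R by rewrite (ler_nat R 2).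
have K16 : 16 * t%:R ^+ 2 + 1 <= k%:R :> R.
  by rewrite -natrX -natrM -(natrD _ _ 1) ler_nat addn1.
split=> //; apply: le_trans K16.
by rewrite lerD2r expr2 mulrA ler_wpM2r //; lra.
Qed.

(** * A clique of nearly constant weight *)

Section Clique.
Context {R : realFieldType} {V : finType} (a : rel V) (x : V -> R) (r : R).
Context (a_irr : irreflexive a) (x01 : forall j, 0 <= x j <= 1).
Context (x_sub : forall j, r * x j <= \sum_i x i * (a i j)%:R).
Context (u : V) (xu : x u = 1) (k t : nat).
Context (num : arcs a setT setT = (k * (k - 1) + t)%N).
Context (t_ge2 : (2 <= t)%N) (k_gt : (16 * t ^ 2 < k)%N) (r_gt : k%:R - 1 < r).
Local Notation K := (k%:R : R).
Local Notation T := (t%:R : R).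
Local Notation flow := (flow a x).

Let x_ge0 j : 0 <= x j. Proof. by case/andP: (x01 j). Qed.
Let x_le1 j : x j <= 1. Proof. by case/andP: (x01 j). Qed.

Let T_ge2 : 2 <= T. Proof. by case: (size_bounds R t_ge2 k_gt). Qed.
Let K_gt : 16 * T ^+ 2 + 1 <= K. Proof. by case: (size_bounds R t_ge2 k_gt). Qed.
Let K_gtT : 32 * T + 1 <= K. Proof. by case: (size_bounds R t_ge2 k_gt). Qed.
Let r_ge0 : 0 <= r.
Proof. by apply: le_trans (ltW r_gt); have := K_gtT; have := T_ge2; lra. Qed.
Let numR : (arcs a setT setT)%:R = K * (K - 1) + T.
Proof. by rewrite num natrD natrM natrB //; apply: leq_trans k_gt. Qed.

(* Few arcs enter [Far] ([arcs_into_Far]), so its vertices are light, and [Core]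
   will turn out to be the clique. The ratio 4t in [Core] is a compromise:
   a vertex of [Core] feeds so much of [N] that its weight must be near 1, while a
   vertex outside [Core] feeds little enough of [N] to be negligible. *)
Let N : {set V} := [set i | a i u].
Let Far : {set V} := ~: (u |: N).
Let Core : {set V} := [set j | (k <= 4 * t * outdeg a j N)%N].
Local Notation d := (#|N|%:R : R).

Let sum_N : r <= \sum_(i in N) x i.
Proof.
have := x_sub u; rewrite xu mulr1 => /le_trans; apply.
rewrite le_eqVlt [X in _ == X]big_mkcond /=; apply/orP; left; apply/eqP.
by apply: eq_bigr => i _; rewrite inE; case: (a i u); rewrite ?mulr1 ?mulr0.
Qed.

Let r_le_d : r <= d.
Proof. exact: le_trans sum_N (sum_le_card x01 _). Qed.

Let K_le_d : K <= d.
Proof.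
rewrite ler_nat; suff : (k < #|N|.+1)%N by [].
by rewrite -(ltr_nat R) -natr1 -ltrBlDr; apply: lt_le_trans r_gt r_le_d.
Qed.

Let uN : u \notin N. Proof. by rewrite inE a_irr. Qed.

Let split_arcs : (arcs a setT N)%:R + d + (arcs a setT Far)%:R = K * (K - 1) + T.
Proof.
rewrite -numR (arcs_setCr _ _ (u |: N)) -/Far natrD; congr (_ + _).
rewrite !arcs_exchange big_setU1 //= natrD addrC; congr (_ + _).
rewrite -sum1_card big_mkcond [in RHS]big_mkcond /=; congr (_%:R).
by apply: eq_bigr => i _; rewrite !inE; case: (a i u).
Qed.

(** Weighing the walks of length 2 that end at [u] bounds [r ^+ 2] by the number of
    arcs into [N], minus a loss for every such arc whose tail is lighter than 1. As
    [u] is not in [N], the arcs into [u] do not count, and since [r ^+ 2] nearly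
    exhausts the number of arcs, the losses and the arcs into [Far] together number
    less than [t]. *)
Let two_walks : (arcs a setT Far)%:R + \sum_j (1 - x j) * (outdeg a j N)%:R
   <= K * (K - 1) + T - d - r ^+ 2.
Proof.
have -> : \sum_j (1 - x j) * (outdeg a j N)%:R = (arcs a setT N)%:R - flow setT N.
  rewrite /arcs natr_sum /flow -sumrB.
  by apply: eq_big => [j|j _]; rewrite ?inE // mulrBl mul1r.
have h : r ^+ 2 <= flow setT N.
  by apply: le_trans (sub_flow x_sub N); rewrite expr2 ler_wpM2l.
move: split_arcs h; set A := (arcs a _ N)%:R; set B := (arcs a _ Far)%:R; lra.
Qed.

Let two_walks_slack : (arcs a setT Far)%:R + \sum_j (1 - x j) * (outdeg a j N)%:R
   <= T + K - 1 - d.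
Proof.
apply: le_trans two_walks _.
by have := r_ge0; have := r_gt; have := K_gtT; have := T_ge2; nra.
Qed.

Let deficit_ge0 (P : {set V}) : 0 <= \sum_(j in P) (1 - x j) * (outdeg a j N)%:R.
Proof. by apply: sumr_ge0 => j _; rewrite mulr_ge0 ?subr_ge0 ?ler0n. Qed.

Let d_le : d <= T + K - 1.
Proof.
have := two_walks_slack; have := deficit_ge0 setT; have := r_gt.
rewrite (eq_bigl xpredT) => [|j]; last by rewrite inE.
have := ler0n R (arcs a setT Far); lra.
Qed.

Let arcs_into_Far : (arcs a setT Far)%:R <= T - 1.
Proof.
have := two_walks_slack; have := deficit_ge0 setT; have := r_gt.
rewrite (eq_bigl xpredT) => [|j]; last by rewrite inE.
have := K_le_d; have := ler0n R (arcs a setT Far); lra.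
Qed.

Let sum_Far : 32 * \sum_(i in Far) x i <= 1.
Proof.
have := sub_flow x_sub Far; have := flow_le_arcs a x01 setT Far.
have := arcs_into_Far; have := sum_ge0 x01 Far; move: K_gtT T_ge2.
move=> h1 h2 h3 h4 h5 h6.
set S := \sum_(_ in _) _ in h3 h5 h6 *.
have h7 : r * S <= T - 1 by lra.
have h8 : 32 * T * S <= r * S by rewrite ler_wpM2r //; have := r_gt; lra.
by rewrite -(ler_pM2l (x := T)); lra.
Qed.

Let sum_deficit_Core : 4 * \sum_(j in Core) (1 - x j) <= 1.
Proof.
have : K * \sum_(j in Core) (1 - x j) <= 4 * T * \sum_j (1 - x j) * (outdeg a j N)%:R.
  rewrite [in leRHS](bigID (mem Core)) /= mulrDr [leLHS]mulr_sumr mulr_sumr.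
  apply: ler_wpDr.
    apply: mulr_ge0; [by rewrite mulr_ge0 |].
    by apply: sumr_ge0 => j _; rewrite mulr_ge0 ?subr_ge0 ?ler0n.
  apply: ler_sum => j; rewrite inE -(ler_nat R) !natrM => jG.
  by rewrite mulrCA [leLHS]mulrC ler_wpM2l ?subr_ge0.
have := two_walks_slack; have := ler0n R (arcs a setT Far).
set X := \sum_(j in Core) _; set Y := \sum_j _ => h1 h2 h3.
have Y_le : Y <= T - 1 by have := K_le_d; lra.
have T2 := T_ge2; have K16 := K_gt.
have : 4 * T * Y <= 4 * T * (T - 1) by rewrite ler_wpM2l //; lra.
by rewrite -(ler_pM2l (x := K)); nra.
Qed.

Let Core_large j : j \in Core -> 3 <= 4 * x j.
Proof.
move=> jG; have := sum_deficit_Core; rewrite (bigD1 j) //=.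
have : 0 <= \sum_(i in Core | i != j) (1 - x i) by apply: sumr_ge0 => i _; rewrite subr_ge0.
lra.
Qed.

Let Far_tiny j : j \in Far -> 32 * x j <= 1.
Proof.
move=> jO; have := sum_Far; rewrite (bigD1 j) //=.
have : 0 <= \sum_(i in Far | i != j) x i by apply: sumr_ge0.
lra.
Qed.

Let Core_sub : Core \subset u |: N.
Proof.
apply/subsetP=> j jG; apply/negPn/negP => jO.
have := Core_large jG; have : 32 * x j <= 1 by apply: Far_tiny; rewrite inE.
lra.
Qed.

Local Notation g := (#|Core|%:R : R).
Local Notation X := (\sum_(j in Core) x j).

Let sum_Core_ge : g - 1/4 <= X.
Proof.
have := sum_deficit_Core; rewrite sumrB sumr_const; lra.
Qed.

Let sum_notCore : 32 * \sum_(j in ~: Core) x j <= 32 * (d + 1 - g) + 1.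
Proof.
rewrite (big_setID Far) /=.
have h1 : \sum_(j in ~: Core :&: Far) x j <= \sum_(j in Far) x j.
  rewrite setIC [leRHS](big_setID (~: Core)) /= lerDl; exact: sum_ge0.
have h2 : \sum_(j in ~: Core :\: Far) x j <= d + 1 - g.
  apply: le_trans (sum_le_card x01 _) _.
  have -> : ~: Core :\: Far = (u |: N) :\: Core.
    by rewrite /Far setDE setCK setDE setIC.
  rewrite lerBrDr -natrD natr1 ler_nat -{2}(setIidPr Core_sub).
  by rewrite addnC cardsID cardsU1 uN.
have := sum_Far; lra.
Qed.

Let flow_notCore_N : 4 * T * flow (~: Core) N <= K * \sum_(j in ~: Core) x j.
Proof.
rewrite !mulr_sumr; apply: ler_sum => j.
rewrite !inE -ltnNge => /ltnW; rewrite -(ler_nat R) !natrM => h.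
by rewrite mulrCA [leRHS]mulrC ler_wpM2l.
Qed.

Let flow_notCore_Core : 4 * T * flow (~: Core) Core <= (K + 4 * T) * \sum_(j in ~: Core) x j.
Proof.
apply: (@le_trans _ _ (4 * T * flow (~: Core) N + 4 * T * \sum_(j in ~: Core) x j)).
  2: by rewrite [leRHS]mulrDl lerD2r flow_notCore_N.
rewrite -mulrDr ler_wpM2l ?mulr_ge0 ?ler0n // -big_split /=.
apply: ler_sum => j _; rewrite -[X in _ <= _ + X]mulr1 -mulrDr ler_wpM2l //.
rewrite natr1 ler_nat -[leqRHS]addn1.
apply: (@leq_trans (outdeg a j (u |: N))).
  by rewrite /outdeg [leqRHS](big_setID Core) /= (setIidPr Core_sub) leq_addr.
by rewrite /outdeg big_setU1 //= addnC leq_add2l; case: (a j u).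
Qed.

(** The walks of length 2 need about [k ^ 2] arcs into [N]; the vertices outside
    [Core] contribute at most an eighth of that, and [N] has about [k] elements. *)
Let card_Core_half : K <= 2 * g.
Proof.
have h0 : r ^+ 2 <= flow setT N.
  by apply: le_trans (sub_flow x_sub N); rewrite expr2 ler_wpM2l ?r_ge0.
have h1 : flow Core N <= g * d.
  apply: le_trans (flow_le_arcs a x01 _ _) _.
  rewrite -natrM ler_nat /arcs -sum_nat_const; apply: leq_sum => j _.
  by rewrite /outdeg -sum1_card; apply: leq_sum => i _; case: (a j i).
rewrite (flow_setCl a x Core) in h0.
have h2 := flow_notCore_N; have h3 := sum_notCore; have h4 := d_le; have h5 := K_le_d.
have := K_gtT; have := T_ge2; have : 0 <= g by rewrite ler0n.
move: h0 h1 h2 h3; set F := flow _ _; set F' := flow _ _; set S := \sum_(_ in ~: _) _.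
move=> h0 h1 h2 h3 g0 T2 KT.
have r2 : (K - 1) ^+ 2 <= r ^+ 2.
  by rewrite lerXn2r ?nnegrE ?r_ge0 // ?(ltW r_gt) //; lra.
rewrite leNgt; apply/negP => gK.
have S_le : S <= d + 2 - g by lra.
have F'_ge0 : 0 <= F' by apply: sumr_ge0 => j _; rewrite mulr_ge0.
have F'_le : 8 * F' <= K * (d + 2 - g).
  apply: (@le_trans _ _ (4 * T * F')); first by rewrite ler_wpM2r //; lra.
  by apply: le_trans h2 _; rewrite ler_wpM2l.
have h6 : 8 * (K - 1) ^+ 2 <= 8 * (g * d) + K * (d + 2 - g) by lra.
have h7 : 0 <= (8 * d - K) * (K - 2 * g) by apply: mulr_ge0; lra.
have h8 : 0 <= K * (K + T - 1 - d) by apply: mulr_ge0; lra.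
have h9 : 0 <= K * (K - 32 * T - 1) by apply: mulr_ge0; lra.
have h10 : 0 <= K * (T - 2) by apply: mulr_ge0; lra.
lra.
Qed.

(** If [Core] had fewer than [k] vertices, arcs inside [Core] could not sustain the
    growth rate [r > k - 1], and the arcs entering [Core] would have to supply
    [k - #|Core|] times its weight, which is more than [flow_notCore_Core] allows. *)
Let card_Core_ge : (k <= #|Core|)%N.
Proof.
rewrite leqNgt; apply/negP; rewrite -(ler_nat R) -natr1 => gk.
have h0 : (r - g + 1) * X <= flow (~: Core) Core.
  have := sub_flow x_sub Core; rewrite (flow_setCl a x Core).
  have : flow Core Core <= (g - 1) * X.
    rewrite mulr_sumr; apply: ler_sum => j jG; rewrite mulrC ler_wpM2r //.
    rewrite lerBrDr natr1 ler_nat -[leqRHS](prednK (n := #|Core|)); last first.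
      by apply/card_gt0P; exists j.
    by rewrite ltnS -(outdeg_missing a_irr jG) leq_addr.
  lra.
have h1 := flow_notCore_Core; have h2 := sum_notCore.
have h3 := sum_Core_ge; have h4 := card_Core_half.
have h5 := d_le; have h6 := K_gtT; have h7 := T_ge2.
move: h0 h1 h2 h3; set F := flow _ _; set S := \sum_(_ in ~: _) _; set Y := \sum_(_ in _) _.
move=> h0 h1 h2 h3.
have T16 := K_gt.
have h8 : (K - g) * Y <= F.
  by apply: le_trans h0; rewrite ler_wpM2r ?sum_ge0 //; have := r_gt; lra.
(* The weight outside [Core] is less than [k - #|Core| + t], up to the 1/32 that
   [sum_Far] leaves to [Far]. *)
have h9 : S <= (K - g) * (T + 33 / 32).
  have h : 0 <= (K - g - 1) * (T + 1 / 32) by apply: mulr_ge0; lra.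
  lra.
have h10 : (K - g) * (K / 2 - 1 / 4) <= F.
  by apply: le_trans h8; rewrite ler_wpM2l //; lra.
have h12 : 4 * T * (K / 2 - 1 / 4) <= (K + 4 * T) * (T + 33 / 32).
  rewrite -(ler_pM2l (x := K - g)); last by lra.
  rewrite mulrCA [leRHS]mulrCA.
  apply: (@le_trans _ _ ((K + 4 * T) * S)); last by rewrite ler_wpM2l //; lra.
  by apply: le_trans h1; rewrite ler_wpM2l //; lra.
have h13 : 0 <= (K - 16 * T ^+ 2 - 1) * (T - 33 / 32) by apply: mulr_ge0; lra.
have h14 : 0 <= T ^+ 2 * (T - 2) by apply: mulr_ge0; [apply: sqr_ge0 | lra].
have h15 : 0 <= T * (T - 2) by apply: mulr_ge0; lra.
nra.
Qed.

(** Conversely, [k + 1] vertices of weight near 1 need more arcs than there are. *)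
Let card_Core : #|Core| = k.
Proof.
apply/eqP; rewrite eqn_leq card_Core_ge andbT leqNgt; apply/negP.
rewrite -(ler_nat R) -natr1 => gk.
have := sub_flow x_sub Core; have := flow_le_arcs a x01 setT Core.
have : (arcs a setT Core)%:R <= K * (K - 1) + T.
  by rewrite -numR ler_nat (arcs_setCr _ setT Core) leq_addr.
move=> h1 h2 h3; have h4 := sum_Core_ge; have h5 := K_gtT; have h6 := T_ge2.
have h7 : (K - 1) * (K + 3 / 4) <= r * X.
  by apply: ler_pM; rewrite ?(ltW r_gt) //; lra.
lra.
Qed.

Let missing_total : ((\sum_(j in Core) missing a Core j) + arcs a Core Core = k * (k - 1))%N.
Proof.
rewrite -[X in (X * _)%N]card_Core /arcs -big_split /= -sum_nat_const; apply: eq_bigr => j jG.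
by rewrite addnC outdeg_missing // card_Core subn1.
Qed.
Local Notation m := (\sum_(j in Core) missing a Core j)%N.

(** Each arc missing inside [Core] costs at least 3/4, the least weight of a vertex
    there, and only arcs entering [Core] from outside can compensate. *)
Let missing_cost : (r - K + 1) * X + 3 / 4 * m%:R <= flow (~: Core) Core.
Proof.
have := sub_flow x_sub Core; rewrite (flow_setCl a x Core).
suff : flow Core Core <= (K - 1) * X - 3 / 4 * m%:R by lra.
rewrite natr_sum !mulr_sumr -sumrB; apply: ler_sum => j jG.
have := outdeg_missing a_irr jG; rewrite card_Core => h.
have {h} : (outdeg a j Core)%:R + (missing a Core j)%:R = K - 1.
  by rewrite -natrD h -subn1 natrB //; apply: leq_trans k_gt.
have := ler0n R (missing a Core j); have := Core_large jG.
set o := (outdeg _ _ _)%:R; set mm := (missing _ _ _)%:R => h1 h2 h3.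
have h : 0 <= (4 * x j - 3) * mm by apply: mulr_ge0; lra.
have -> : o = K - 1 - mm by lra.
lra.
Qed.

Lemma indeg_bound j : r * x j <= (\sum_i a i j)%:R.
Proof.
apply: le_trans (x_sub j) _; rewrite natr_sum; apply: ler_sum => i _.
by rewrite ler_piMl ?ler0n.
Qed.

(** A vertex outside [Core] weighs at most its in-degree over [r], so what it sends
    into [Core] is at most a product of two arc counts; the arcs counted are
    distinct and there are [t + m] of them, whence the arithmetic-geometric mean
    bound. *)
Let flow_notCore_le : 4 * r * flow (~: Core) Core <= (T + m%:R) ^+ 2.
Proof.
set A := (arcs a setT (~: Core))%:R : R; set B := (arcs a (~: Core) Core)%:R : R.
have AB : A + B <= T + m%:R.
  have h : (arcs a setT (~: Core) + arcs a (~: Core) Core = t + m)%N.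
    have := num; rewrite (arcs_setCr _ setT Core) (arcs_setCl _ Core Core).
    rewrite -missing_total.
    move: (arcs a Core Core) (arcs a (~: Core) Core) (arcs a _ (~: Core)) m.
    by move=> n1 n2 n3 n4; clear; lia.
  by rewrite -!natrD h.
have h : r * flow (~: Core) Core <= A * B.
  rewrite mulr_sumr /B /arcs natr_sum mulr_sumr; apply: ler_sum => j jG.
  rewrite mulrA ler_wpM2r //; apply: le_trans (indeg_bound j) _.
  rewrite ler_nat arcs_exchange [leqRHS](bigD1 j) //=.
  rewrite -[leqLHS]addn0 leq_add // leq_eqVlt; apply/orP; left; apply/eqP.
  by apply: eq_bigl => i; rewrite inE.
have A0 : 0 <= A by []. have B0 : 0 <= B by [].
have h2 : (A + B) ^+ 2 <= (T + m%:R) ^+ 2.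
  by rewrite lerXn2r ?nnegrE ?addr_ge0.
apply: le_trans h2; rewrite -mulrA; have := sqr_ge0 (A - B); lra.
Qed.

(** The cost of the missing arcs is linear in [m], the gain is quadratic in [t + m]
    but divided by [r]; a first crude bound on [m] makes the gain smaller than the
    cost of a single arc. *)
Let missing_eq0 : m = 0%N.
Proof.
have hX : 0 <= (r - K + 1) * X.
  by rewrite mulr_ge0 ?sum_ge0 //; have := r_gt; lra.
have h1 := missing_cost; have h2 := flow_notCore_Core; have h3 := sum_notCore.
have h4 := flow_notCore_le; have h5 := d_le; rewrite card_Core in h3.
move: K_gtT T_ge2 K_gt => h6 h7 h8.
apply/eqP; rewrite -leqn0 -ltnS -(ltr_nat R).
have m0 : 0 <= m%:R :> R by [].
move: m0 h1 h2 h3 h4 hX; set M := (m%:R : R); set F := flow _ _.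
set S := \sum_(_ in ~: _) _; set Y := _ * X => m0 h1 h2 h3 h4 hX.
(* The estimate [flow_notCore_Core] brings [t + m] below [r]; then
   [flow_notCore_le] becomes linear in [t + m] and brings [m] below [t]; used once
   more, it makes the flow at most 1/16. *)
have F_le : 2 * F <= K + 4 * T.
  rewrite -(ler_pM2l (x := 2 * T)); last by lra.
  apply: (@le_trans _ _ ((K + 4 * T) * S)); first lra.
  by rewrite mulrC ler_wpM2r //; lra.
have rK := r_gt; have TM : T + M <= r by lra.
have F_le2 : 4 * F <= T + M.
  rewrite -(ler_pM2l (x := r)); last by lra.
  rewrite mulrA [r * 4]mulrC; apply: le_trans h4 _.
  by rewrite expr2 ler_wpM2r //; lra.
have h9 : (T + M) ^+ 2 <= (2 * T) ^+ 2.
  by rewrite lerXn2r ?nnegrE //; lra.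
have T0 : 0 < T ^+ 2 by rewrite exprn_gt0 //; lra.
have F_le3 : 16 * F <= 1.
  rewrite -(ler_pM2l T0).
  have : 16 * T ^+ 2 * F <= r * F by rewrite ler_wpM2r //; lra.
  lra.
lra.
Qed.

(** The total weight is recorded because the comparison of the arcs outside the
    clique needs it to be [k] up to a bounded error. *)
Lemma exists_heavy_clique : exists S : {set V},
  [/\ #|S| = k, {in S &, forall i j, a i j = (i != j)}
    & K - 1/4 <= \sum_(j in S) x j].
Proof.
exists Core; split=> //; last by have := sum_Core_ge; rewrite card_Core.
move=> i j iG jG; have [<-|ij] := eqVneq; first exact: a_irr.
have /eqP := missing_eq0; rewrite sum_nat_eq0 => /forall_inP/(_ i iG).
rewrite sum_nat_eq0 => /forall_inP/(_ j); rewrite in_setD1 eq_sym ij jG => /(_ isT).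
by case: (a i j).
Qed.
End Clique.

(** * The arcs outside the clique *)

Lemma half_add_uphalf t : (t./2 + uphalf t = t)%N.
Proof. by rewrite uphalf_half addnCA addnn odd_double_half. Qed.

Lemma half_mul_max p q t : (p + q = t -> p * q <= t./2 * uphalf t)%N.
Proof.
have := half_add_uphalf t; have := uphalf_half t.
move: (t./2) (uphalf t) (leq_b1 (odd t)) => h H; move: (nat_of_bool _) => b b1.
move=> -> tE pq; have [ph|hp] := leqP p h.
  have hE : h = (p + (h - p))%N by lia.
  have -> : q = (b + p + 2 * (h - p))%N by lia.
  by rewrite hE; move: (h - p)%N => m; rewrite addKn; nia.
have -> : p = (h + b + (p - h - b))%N by lia.
have -> : q = (h - (p - h - b))%N by lia.
move: (p - h - b)%N => m; have [mh|hm] := leqP m h; last first.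
  by rewrite (eqP (ltnW hm)) muln0.
by have := subnK mh; move: (h - m)%N => n <-; nia.
Qed.

Lemma half_mul_eq p q t : (p + q = t -> p * q = t./2 * uphalf t ->
  p = t./2 /\ q = uphalf t \/ p = uphalf t /\ q = t./2)%N.
Proof.
have := half_add_uphalf t; move: (t./2) (uphalf t) => h H <- pq pqE.
have : (p == h) || (p == H).
  by apply/negPn/negP; rewrite negb_or => /andP[/eqP ph /eqP pH]; nia.
by case/orP => /eqP pE; [left | right]; lia.
Qed.

(** Read [p w] and [q w] as the numbers of arcs from the clique to [w] and back, and
    [z] as the number of arcs avoiding the clique. If [p v] is the largest [p w],
    then the sum of the products is at most [p v * \sum q], and since
    [t - p v] exceeds [\sum q] by everything else that is spent, spending anything
    away from [v] drops the product below the product of the two halves of [t]. *)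
Lemma concentration (V : finType) (W : {set V}) (p q : V -> nat) (z t : nat) :
    (2 <= t)%N -> (\sum_(w in W) p w + \sum_(w in W) q w + z = t)%N ->
    (t./2 * uphalf t <= \sum_(w in W) p w * q w)%N ->
  z = 0%N /\ exists v, [/\ v \in W, (p v + q v = t)%N,
     (p v * q v = t./2 * uphalf t)%N
   & {in W, forall w, w != v -> p w = 0%N /\ q w = 0%N}].
Proof.
move=> t2 tot big.
have P_gt0 : (0 < t./2 * uphalf t)%N.
  by rewrite uphalf_half; case: t t2 {tot big} => [|[|t]] //= _; rewrite addnS.
have [w0 w0W] : exists w, w \in W.
  apply/set0Pn; apply: contraTneq (leq_trans P_gt0 big) => ->.
  by rewrite big_set0.
case: (arg_maxnP p w0W) => v vW vmax.
have le_b : (\sum_(w in W) p w * q w <= p v * \sum_(w in W) q w)%N.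
  rewrite big_distrr /=; apply: leq_sum => w wW.
  by rewrite leq_mul2r; apply/orP; right; apply: vmax.
rewrite (bigD1 v vW) /= in tot.
have := @half_mul_max (p v) (t - p v) t.
set A := (\sum_(w in W | w != v) p w)%N in tot *.
set b := (\sum_(w in W) q w)%N in tot le_b *.
move: (leq_trans big le_b) tot P_gt0; set P := (t./2 * uphalf t)%N.
move=> Pb tot P_gt0 hP.
have pv_gt0 : (0 < p v)%N by nia.
have tE : (t - p v = A + z + b)%N by lia.
have {hP} : (p v * (A + z + b) <= P)%N by rewrite -tE hP //; lia.
rewrite mulnDr => hP.
have Az0 : (p v * (A + z) = 0)%N by lia.
have {Az0} [A0 z0] : A = 0%N /\ z = 0%N by nia.
split=> //.
have p0 : {in W, forall w, w != v -> p w = 0%N}.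
  move=> w wW wv; move/eqP: A0; rewrite sum_nat_eq0 => /forall_inP/(_ w).
  by rewrite wW wv => /(_ isT)/eqP.
move: big; rewrite (bigD1 v vW) /= big1 ?addn0 => [big|w /andP[wW wv]]; last first.
  by rewrite p0.
move: tot Pb hP; rewrite /b (bigD1 v vW) /= A0 z0 !addn0.
set b' := (\sum_(w in W | w != v) q w)%N => tot Pb hP.
have b0 : b' = 0%N by rewrite mulnDr in hP; nia.
exists v; split=> //.
- by rewrite -tot b0 addn0.
- by move: hP; rewrite b0 addn0; rewrite -/P in big; lia.
- move=> w wW wv; split; first exact: p0.
  move/eqP: b0; rewrite sum_nat_eq0 => /forall_inP/(_ w).
  by rewrite wW wv => /(_ isT)/eqP.
Qed.

Section Rigidity.
Context {R : realFieldType} {V : finType} (a : rel V) (x : V -> R) (r rho : R).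
Context (a_irr : irreflexive a) (x01 : forall j, 0 <= x j <= 1).
Context (x_sub : forall j, r * x j <= \sum_i x i * (a i j)%:R).
Context (k t : nat) (S : {set V}).
Context (num : arcs a setT setT = (k * (k - 1) + t)%N).
Context (t_ge2 : (2 <= t)%N) (k_gt : (16 * t ^ 2 < k)%N).
Local Notation K := (k%:R : R).
Local Notation T := (t%:R : R).
Local Notation h := (t./2%:R : R).
Local Notation P := ((t./2 * uphalf t)%:R : R).
Local Notation flow := (flow a x).
Context (rho_gt : K - 1 < rho) (rho_le_r : rho <= r).
Context (rho_eq : (rho - K + 1) * (rho * (rho + 1) - h) = P).
Context (cardS : #|S| = k) (cliqueS : {in S &, forall i j, a i j = (i != j)}).
Local Notation X := (\sum_(j in S) x j).
Context (X_ge : K - 1/4 <= X).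

Let x_ge0 j : 0 <= x j. Proof. by case/andP: (x01 j). Qed.
Let x_le1 j : x j <= 1. Proof. by case/andP: (x01 j). Qed.

Lemma rigidity_bounds : [/\ 2 <= T, 16 * T ^+ 2 + 1 <= K, 32 * T + 1 <= K & K - 1 < r].
Proof.
have [T2 K16 K32] := size_bounds R t_ge2 k_gt.
by split=> //; apply: lt_le_trans rho_gt rho_le_r.
Qed.

Lemma rho_factor_ge0 : 0 <= rho * (rho + 1) - h.
Proof.
have [T2 _ K32 _] := rigidity_bounds; have rhoK := rho_gt.
have h_le : h <= T by rewrite ler_nat -[leqRHS]half_add_uphalf leq_addr.
have T_le : T * 1 <= rho * (rho + 1) by apply: ler_pM; lra.
lra.
Qed.

Let p w := (\sum_(i in S) a i w)%N.
Let q w := outdeg a w S.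

Lemma clique_outdeg j : j \in S -> outdeg a j S = (k - 1)%N.
Proof.
move=> jS; rewrite -cardS subn1 -(outdeg_missing a_irr jS).
rewrite /missing big1 ?addn0 // => i; rewrite in_setD1 => /andP[ij iS].
by rewrite cliqueS // eq_sym ij.
Qed.

Lemma outer_arcs :
  (\sum_(w in ~: S) p w + \sum_(w in ~: S) q w + arcs a (~: S) (~: S) = t)%N.
Proof.
have cl : arcs a S S = (k * (k - 1))%N.
  by rewrite -[Z in (Z * _)%N]cardS -sum_nat_const; apply: eq_bigr => j /clique_outdeg.
have -> : (\sum_(w in ~: S) p w = arcs a S (~: S))%N by rewrite arcs_exchange.
have := num; rewrite (arcs_setCl _ S) !(arcs_setCr _ _ S) cl.
by rewrite -/(arcs a (~: S) S); lia.
Qed.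

(** Inside the clique the weight grows exactly by the factor [k - 1]; the excess of
    [r] must come from the outside. *)
Lemma clique_growth : (r - K + 1) * X <= \sum_(w in ~: S) x w * (q w)%:R.
Proof.
have := sub_flow x_sub S; rewrite (flow_setCl a x S).
suff -> : flow S S = (K - 1) * X by rewrite -/(flow (~: S) S); lra.
rewrite mulr_sumr; apply: eq_bigr => j jS; rewrite clique_outdeg // mulrC.
by rewrite natrB //; apply: leq_trans k_gt.
Qed.

(** To leading order [r * (r - k + 1) * X], where [X] is the weight of the clique,
    is at most the number of walks of length 2 from the clique to itself through an
    outer vertex. All corrections are of order [t ^ 2 / k], hence too small
    to make up for an integer smaller by 1. *)
Lemma outer_products : (t./2 * uphalf t <= \sum_(w in ~: S) p w * q w)%N.
Proof.
have [T2 K16 K32 rK] := rigidity_bounds.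
have rhoK := rho_gt; have rho_r := rho_le_r; have XK := X_ge.
rewrite leqNgt; apply/negP; rewrite -(ler_nat R) -natr1 => small.
have r_gt0 : 0 < r by lra.
have sumW : r * \sum_(w in ~: S) x w <= T.
  apply: le_trans (sub_flow x_sub _) _; apply: le_trans (flow_le_arcs a x01 _ _) _.
  rewrite ler_nat -outer_arcs (arcs_setCl _ S) !arcs_exchange.
  by rewrite leq_add2r leq_addr.
have xw w : r * (r * x w) <= r * (p w)%:R + T.
  apply: le_trans (_ : r * ((p w)%:R + \sum_(i in ~: S) x i) <= _); last first.
    by rewrite mulrDr lerD2l.
  rewrite ler_pM2l //; apply: le_trans (x_sub w) _.
  rewrite (bigID (mem S)) /= natr_sum; apply: lerD.
    by apply: ler_sum => i _; rewrite ler_piMl.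
  rewrite (eq_bigl (mem (~: S))) => [|i]; last by rewrite !inE.
  by apply: ler_sum => i _; rewrite ler_piMr // lern1 leq_b1.
set Q := (\sum_(w in _) _)%N in small.
have up : r * (r * ((r - K + 1) * X)) <= r * Q%:R + T ^+ 2.
  apply: (@le_trans _ _ (r * (r * \sum_(w in ~: S) x w * (q w)%:R))).
    by rewrite !ler_pM2l // clique_growth.
  apply: (@le_trans _ _ (\sum_(w in ~: S) (r * (p w)%:R + T) * (q w)%:R)).
    rewrite !mulr_sumr; apply: ler_sum => w _.
    by rewrite !mulrA ler_wpM2r // -mulrA.
  rewrite (eq_bigr (fun w => r * (p w * q w)%:R + T * (q w)%:R)); last first.
    by move=> w _; rewrite natrM; ring.
  rewrite big_split /= -!mulr_sumr -!natr_sum lerD2l expr2 ler_wpM2l //.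
  by rewrite ler_nat -outer_arcs addnAC leq_addl.
have mono : P <= (r - K + 1) * (r * (r + 1)).
  rewrite -rho_eq; apply: ler_pM; [lra | exact: rho_factor_ge0 | lra | ].
  apply: (@le_trans _ _ (rho * (rho + 1))); first by rewrite gerBl.
  by apply: ler_pM; lra.
have P_le : 4 * P <= T ^+ 2.
  have tE : T = h + (uphalf t)%:R by rewrite -natrD half_add_uphalf.
  by rewrite tE natrM; have := sqr_ge0 (h - (uphalf t)%:R); lra.
move: up mono P_le small; set PP := (_%:R : R); set D := r - K + 1; move: (Q%:R : R) => Q'.
move=> up mono P_le small.
have D_gt0 : 0 < D by rewrite /D; lra.
have up2 : r * (D * X) <= Q' + 1/16.
  rewrite -(ler_pM2l r_gt0); apply: le_trans up _; rewrite mulrDr lerD2l; lra.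
have rD : 64 * (r * D) <= 1.
  have T2_gt0 : 0 < T ^+ 2 by rewrite exprn_gt0 //; lra.
  have h1 : 16 * T ^+ 2 * (r * D) <= X * (r * D).
    by rewrite ler_wpM2r ?mulr_ge0 ?(ltW D_gt0) ?(ltW r_gt0) //; lra.
  by rewrite -(ler_pM2l T2_gt0); lra.
have D_le : D <= r * D by rewrite ler_peMl ?(ltW D_gt0) //; lra.
have h2 : r * D * (r + 1) <= r * D * (X + 1/4 + 1/64).
  by rewrite ler_wpM2l ?mulr_ge0 ?(ltW D_gt0) ?(ltW r_gt0) //; rewrite /D in rD D_le *; lra.
lra.
Qed.

(** Once all outer arcs are at one vertex [v], the inequalities for [v] and for the
    clique can be solved exactly: with [c] the number of clique vertices joined to
    [v] in both directions, [(r - k + 1) * (r * (r + 1) - c) <= #|In| * #|Out|].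
    Comparison with the equation of [rho] forces [c] to be as large as possible,
    which means that [In] and [Out] are nested, and forces [r = rho]. *)
Lemma rigidity : r = rho /\ exists v (into : bool),
  let In := [set i in S | a i v] in let Out := [set i in S | a v i] in
  [/\ v \notin S,
     forall w i, w \notin S -> w != v -> ~~ a w i && ~~ a i w,
     #|In| = (if into then uphalf t else t./2),
     #|Out| = (if into then t./2 else uphalf t) &
     if into then Out \subset In else In \subset Out].
Proof.
have [T2 K16 K32 rK] := rigidity_bounds; have r_gt0 : 0 < r by lra.
have rhoK := rho_gt; have rho_r := rho_le_r; have XK := X_ge.
have [arcsW [v [vW pqt pqP pq0]]] := concentration t_ge2 outer_arcs outer_products.
have vS : v \notin S by rewrite -in_setC.
have noW w i : w \in ~: S -> i \in ~: S -> a w i = false.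
  move=> wW iW; move/eqP: arcsW; rewrite sum_nat_eq0 => /forall_inP/(_ w wW).
  by rewrite sum_nat_eq0 => /forall_inP/(_ i iW); case: (a w i).
have no_in w i : w \in ~: S -> w != v -> i \in S -> a i w = false.
  move=> wW wv iS; have [/eqP+ _] := pq0 w wW wv.
  by rewrite sum_nat_eq0 => /forall_inP/(_ i iS); case: (a i w).
have no_out w i : w \in ~: S -> w != v -> i \in S -> a w i = false.
  move=> wW wv iS; have [_ /eqP+] := pq0 w wW wv.
  by rewrite sum_nat_eq0 => /forall_inP/(_ i iS); case: (a w i).
set In := [set i in S | a i v]; set Out := [set i in S | a v i].
have card_pred (A : {set V}) (b : pred V) :
    (\sum_(i in A) b i = #|[set i in A | b i]|)%N.
  rewrite -sum1_card big_mkcond [RHS]big_mkcond /=; apply: eq_bigr => i _.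
  by rewrite inE; case: (i \in A).
have pE : p v = #|In| by rewrite /p card_pred.
have qE : q v = #|Out| by rewrite /q /outdeg card_pred.
set c := #|In :&: Out|.
have xv : r * x v <= \sum_(i in In) x i.
  apply: le_trans (x_sub v) _; rewrite (bigID (mem S)) /= [Z in _ + Z]big1 ?addr0.
    rewrite big_mkcond [leRHS]big_mkcond /=; apply: ler_sum => i _; rewrite !inE.
    by case: (i \in S) (a i v) => [] [] //=; rewrite ?mulr1 ?mulr0.
  by move=> i iW; rewrite noW ?mulr0 // inE.
have xi i : i \in S -> (r + 1) * x i <= X + x v * (a v i)%:R.
  move=> iS; rewrite mulrDl mul1r -lerBrDr; apply: le_trans (x_sub i) _.
  rewrite (bigID (mem S)) /= [leRHS](_ : _ = X - x i + x v * (a v i)%:R); last by ring.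
  apply: lerD.
    rewrite [in leRHS](bigD1 i iS) /= [leRHS]addrAC subrr add0r.
    rewrite (bigD1 i iS) /= a_irr mulr0 add0r; apply: ler_sum => j _.
    by rewrite ler_piMr // lern1 leq_b1.
  rewrite (bigD1 v vS) /= big1 ?addr0 // => w /andP[wW wv].
  by rewrite no_out ?mulr0 // inE.
have main : r * (r + 1) * x v <= (#|In|)%:R * X + c%:R * x v.
  rewrite mulrAC mulrC; apply: (@le_trans _ _ ((r + 1) * \sum_(i in In) x i)).
    by rewrite ler_wpM2l //; lra.
  rewrite mulr_sumr; apply: (@le_trans _ _ (\sum_(i in In) (X + x v * (a v i)%:R))).
    by apply: ler_sum => i; rewrite inE => /andP[iS _]; apply: xi.
  rewrite big_split /= sumr_const mulr_natl lerD2l -mulr_sumr -natr_sum mulrC card_pred.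
  rewrite ler_wpM2r // ler_nat; apply: subset_leq_card; apply/subsetP => i.
  by rewrite !inE => /andP[/andP[-> ->] ->].
have growth : (r - K + 1) * X <= #|Out|%:R * x v.
  apply: le_trans clique_growth _.
  rewrite (bigD1 v vW) /= big1 ?addr0 => [|w /andP[wW wv]].
    by rewrite qE mulrC.
  by have [_ ->] := pq0 w wW wv; rewrite mulr0.
have D_gt0 : 0 < r - K + 1 by lra.
have X_gt0 : 0 < X by lra.
have xv_gt0 : 0 < x v.
  rewrite lt_def x_ge0 andbT; apply/eqP => xv0.
  by move: growth; rewrite xv0 mulr0 leNgt mulr_gt0.
have upper : (r - K + 1) * (r * (r + 1) - c%:R) <= P.
  rewrite -(ler_pM2r xv_gt0) -pqP pE qE natrM.
  have h1 := ler_wpM2l (ltW D_gt0) main.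
  have h2 := ler_wpM2l (ler0n R #|In|) growth.
  lra.
have hrho := rho_factor_ge0.
have mono : rho * (rho + 1) <= r * (r + 1) by apply: ler_pM; lra.
have lower : P <= (r - K + 1) * (r * (r + 1) - h).
  by rewrite -rho_eq; apply: ler_pM => //; lra.
have c_ge : (t./2 <= c)%N.
  rewrite -(ler_nat R); have := le_trans upper lower.
  by rewrite ler_pM2l // lerD2l lerN2.
have c_le1 : (c <= #|In|)%N by apply: subset_leq_card; rewrite subsetIl.
have c_le2 : (c <= #|Out|)%N by apply: subset_leq_card; rewrite subsetIr.
have split_pq := half_mul_eq pqt pqP; rewrite pE qE in split_pq.
have c_eq : c = t./2.
  apply/eqP; rewrite eqn_leq c_ge andbT.
  by case: split_pq => -[h1 h2]; [rewrite -h1 | rewrite -h2].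
split.
  apply/eqP; rewrite eq_le rho_le_r andbT leNgt; apply/negP => lt_r.
  rewrite c_eq -rho_eq in upper; move: upper; rewrite leNgt => /negP; apply.
  apply: ltr_pM => //; [lra | lra | ].
  by rewrite ltrD2r; apply: ltr_pM; lra.
exists v, (#|Out| == t./2); rewrite -/In -/Out; split=> //.
- move=> w i wS wv; have wW : w \in ~: S by rewrite inE.
  have [iS|iS] := boolP (i \in S).
    by rewrite (no_in w) ?(no_out w).
  by rewrite !noW ?inE.
- by case: eqP => Out_eq; case: split_pq => -[h1 h2]; congruence.
- by case: eqP => Out_eq; case: split_pq => -[h1 h2]; congruence.
- case: eqP => [Out_eq|nOut].
    suff <- : In :&: Out = Out by apply: subsetIl.
    by apply/eqP; rewrite eqEcard subsetIr Out_eq.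
  suff <- : In :&: Out = In by apply: subsetIr.
  apply/eqP; rewrite eqEcard subsetIl /=.
  by case: split_pq => -[h1 h2] //; rewrite h1.
Qed.
End Rigidity.

(** * Spectral radius and eigenvectors *)

Lemma num_arcsE (D : digraph) : num_arcs D = arcs (@arc D) [set: D] [set: D].
Proof.
rewrite /num_arcs -sum1_card /arcs /outdeg pair_big /= big_mkcond [RHS]big_mkcond /=.
by apply: eq_bigr => -[i j] _; rewrite !inE /=; case: (arc i j).
Qed.

Lemma eigenvalue_adjacencyP (F : fieldType) (D : digraph) (z : F) :
  reflect (exists2 f : D -> F, exists i, f i != 0 &
             forall j, \sum_i f i * (arc i j)%:R = z * f j)
          (eigenvalue (adjacency F D) z).
Proof.
apply: (iffP eigenvalueP) => [[v vz v0]|[f [i fi] fz]].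
  exists (fun i => v 0 (enum_rank i)).
    have /rV0Pn[i vi] := v0; exists (enum_val i); by rewrite enum_valK.
  move=> j; have /rowP/(_ (enum_rank j)) := vz; rewrite !mxE => <-.
  rewrite (reindex _ (onW_bij _ (@enum_val_bij D))) /=.
  by apply: eq_bigr => i _; rewrite enum_valK mxE enum_rankK.
exists (\row_i f (enum_val i)).
  apply/rowP => j; rewrite !mxE -fz (reindex _ (onW_bij _ (@enum_val_bij D))) /=.
  by apply: eq_bigr => l _; rewrite !mxE.
apply/rV0Pn; exists (enum_rank i); by rewrite mxE enum_rankK.
Qed.

Section SpectralRadius.
Local Open Scope complex_scope.
Import ComplexField.Normc.

(** The moduli of the coordinates of an eigenvector, by the triangle inequality. This
    inequality, valid for every digraph, replaces the Perron vector. *)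
Lemma spectral_radius_subvector (R : realType) (D : digraph) : (0 < #|D|)%N ->
  exists (x : D -> R) (u : D), [/\ forall j, 0 <= x j <= 1, x u = 1
    & forall j, spectral_radius R D * x j <= \sum_i x i * (arc i j)%:R].
Proof.
move=> /spectral_radius_max -/(_ R)[z /eigenvalue_adjacencyP[f [i0 fi0] fz] [zE _]].
pose y i := normc (f i).
have normE (w : R[i]) : `|w| = (normc w)%:C by case: w.
have y_sub j : spectral_radius R D * y j <= \sum_i y i * (arc i j)%:R.
  rewrite -lecR rmorphM /= -zE -normE -normrM -fz rmorph_sum /=.
  apply: le_trans (ler_norm_sum _ _ _) _; apply: ler_sum => i _.
  by rewrite normrM normr_nat rmorphM /= rmorph_nat -normE.
have [u _ umax] := @arg_maxP _ _ _ i0 xpredT y isT.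
have {}umax i : y i <= y u by apply: umax.
have yu : 0 < y u.
  apply: lt_le_trans (umax i0); rewrite -ltcR -normE; by rewrite normr_gt0.
exists (fun i => y i / y u), u; split=> [j||j].
- rewrite divr_ge0 ?(ltW yu) //=; last by rewrite -lecR -normE normr_ge0.
  by rewrite ler_pdivrMr // mul1r umax.
- by rewrite divff // gt_eqF.
- rewrite mulrA (eq_bigr (fun i => y i * (arc i j)%:R / y u)); last first.
    by move=> i _; rewrite mulrAC.
  by rewrite -mulr_suml ler_wpM2r // invr_ge0 ltW.
Qed.

Lemma eigenvector_le_spectral_radius (R : realType) (D : digraph) (rho : R)
    (f : D -> R) (i : D) : 0 <= rho -> f i != 0 ->
    (forall j, \sum_i f i * (arc i j)%:R = rho * f j) ->
  rho <= spectral_radius R D.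
Proof.
move=> rho0 fi fz; have D0 : (0 < #|D|)%N by apply/card_gt0P; exists i.
have [z _ [zE /(_ rho%:C)]] := spectral_radius_max R D0.
rewrite zE ger0_norm ?lecR //; apply.
apply/eigenvalue_adjacencyP; exists (fun i => (f i)%:C).
  by exists i; rewrite fmorph_eq0.
move=> j; rewrite -rmorphM -fz rmorph_sum; apply: eq_bigr => l _.
by rewrite rmorphM /= rmorph_nat.
Qed.

End SpectralRadius.

(** * Isomorphism up to isolated vertices *)

(** An eigenvector for a nonzero eigenvalue vanishes at isolated vertices, so it can
    be carried over and extended by 0. *)
Lemma iso_eigenvector (F : idomainType) (D H : digraph) (z : F) (g : H -> F) :
    iso_up_to_isolated D H ->
    (forall y, \sum_i g i * (arc i y)%:R = z * g y) ->
    z != 0 -> (exists y, g y != 0) ->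
  exists f : D -> F, (exists i, f i != 0) /\
    forall j, \sum_i f i * (arc i j)%:R = z * f j.
Proof.
move=> [f [fbij farc]] gz z0 [y0 gy0].
have isolated_l (D' : digraph) (i j : D') : isolated i -> arc i j = false.
  by move/forallP => /(_ j) /andP[/negbTE].
have isolated_r (D' : digraph) (i j : D') : isolated i -> arc j i = false.
  by move/forallP => /(_ j) /andP[_ /negbTE].
have y0n : ~~ isolated y0.
  have: z * g y0 != 0 by rewrite mulf_neq0.
  apply: contraNN => iso; rewrite -gz big1 // => i _.
  by rewrite isolated_r ?mulr0.
have sumE (D' : digraph) (e : D' -> F) j : \sum_i e i * (arc i j)%:R =
    \sum_(i : delete_isolated D') e (val i) * (arc (val i) j)%:R.
  rewrite (bigID (fun i => ~~ isolated i)) /= [Y in _ + Y]big1 ?addr0; last first.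
    by move=> i /negPn iso; rewrite isolated_l ?mulr0.
  rewrite (reindex_omap (val : delete_isolated D' -> D') insub) => [|i ni].
    by apply: eq_bigl => i; rewrite valK eqxx (valP i).
  by rewrite insubT.
pose e (i : D) := if insub i is Some i' then g (val (f i')) else 0.
have eval (i : delete_isolated D) : e (val i) = g (val (f i)) by rewrite /e valK.
have [f' fK f'K] := fbij.
exists e; split.
  by exists (val (f' (Sub y0 y0n))); rewrite eval f'K.
move=> j; have [iso|niso] := boolP (isolated j).
  rewrite /e insubN ?negbK // mulr0 big1 // => i _.
  by rewrite isolated_r ?mulr0.
have -> : j = val (Sub j niso : delete_isolated D) by [].
rewrite eval -gz [LHS]sumE [RHS]sumE [RHS](reindex f) /=; last exact: onW_bij.
apply: eq_bigr => i _; have := farc i (Sub j niso).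
by rewrite eval /= => ->.
Qed.

Lemma iso_of_embedding (D H : digraph) (h : H -> D) : injective h ->
    (forall x y, arc (h x) (h y) = arc x y) ->
    (forall z, ~~ isolated z -> exists x, h x = z) ->
  iso_up_to_isolated D H.
Proof.
move=> h_inj h_arc h_surj.
have iso_h y : isolated (h y) = isolated y.
  apply/forallP/forallP => iso z; first by have := iso (h z); rewrite !h_arc.
  have [/h_surj[w <-]|] := boolP (~~ isolated z); first by rewrite !h_arc.
  by rewrite negbK => /forallP/(_ (h y)); rewrite andbC.
have hP (y : delete_isolated H) : ~~ isolated (h (val y)).
  by rewrite iso_h; apply: (valP y).
pose g (y : delete_isolated H) : delete_isolated D := Sub (h (val y)) (hP y).
have g_bij : bijective g.
  have g_inj : injective g.
    by move=> y z /(congr1 val) /= /h_inj; apply: val_inj.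
  have g_surj z : exists y, g y == z.
    have [y hy] := h_surj _ (valP z).
    have yn : ~~ isolated y by rewrite -iso_h hy (valP z).
    by exists (Sub y yn); rewrite -val_eqE /= hy.
  exists (fun z => xchoose (g_surj z)) => [y|z].
    by apply: g_inj; apply/eqP; apply: (xchooseP (g_surj (g y))).
  by apply/eqP; apply: (xchooseP (g_surj z)).
have [g' gK g'K] := g_bij.
exists g'; split; first by exists g.
by move=> y z; rewrite -{2}(g'K y) -{2}(g'K z) /= h_arc.
Qed.

Lemma mem_nth_prefix (T : eqType) (x0 : T) (s1 s2 : seq T) (i : nat) :
  uniq (s1 ++ s2) -> (i < size (s1 ++ s2))%N ->
  (nth x0 (s1 ++ s2) i \in s1) = (i < size s1)%N.
Proof.
rewrite cat_uniq nth_cat size_cat => /and3P[_ /hasPn s12 _] lti.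
have [i1|i1] := ltnP; first by rewrite mem_nth.
apply/negbTE; apply: s12; apply: mem_nth.
by rewrite ltn_subLR.
Qed.

(** The vertices of the clique are numbered so that the smaller of the two nested
    neighbourhoods of [v] comes first, then the rest of the larger one; both then
    become initial segments, as in [Dsharp]. *)
Lemma iso_Dsharp (D : digraph) (k t : nat) (S : {set D}) (v : D) (into : bool) :
  (uphalf t <= k)%N -> #|S| = k -> {in S &, forall i j, arc i j = (i != j)} ->
  let In := [set i in S | arc i v] in let Out := [set i in S | arc v i] in
   v \notin S ->
     (forall w i, w \notin S -> w != v -> ~~ arc w i && ~~ arc i w) ->
     #|In| = (if into then uphalf t else t./2) ->
     #|Out| = (if into then t./2 else uphalf t) ->
     (if into then Out \subset In else In \subset Out) ->
  iso_up_to_isolated D (Dsharp k t into).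
Proof.
move=> tk cardS cliqueS In Out vS iso_rest cardIn cardOut nested.
have [U [W [[US WU cardU cardW InE] OutE]]] : exists U W : {set D}, [/\
    U \subset S, W \subset U, #|U| = uphalf t, #|W| = t./2 &
    In = (if into then U else W)] /\ Out = (if into then W else U).
  have InS : In \subset S by apply/subsetP => i; rewrite inE => /andP[].
  have OutS : Out \subset S by apply/subsetP => i; rewrite inE => /andP[].
  by case: into cardIn cardOut nested => *; [exists In, Out | exists Out, In].
pose s := enum W ++ enum (U :\: W) ++ enum (S :\: U) ++ [:: v].
have sizeWU : size (enum W ++ enum (U :\: W)) = uphalf t.
  by rewrite size_cat -!cardE -cardU -(cardsID W U) (setIidPr WU).
have sizeS : size (enum W ++ enum (U :\: W) ++ enum (S :\: U)) = k.
  by rewrite catA size_cat sizeWU -cardE -cardS -(cardsID U S) (setIidPr US) cardU.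
have memU z : (z \in enum W ++ enum (U :\: W)) = (z \in U).
  rewrite mem_cat !mem_enum in_setD; case: (boolP (z \in W)) => //=.
  by move/(subsetP WU) => ->.
have memS z : (z \in enum W ++ enum (U :\: W) ++ enum (S :\: U)) = (z \in S).
  rewrite catA mem_cat memU mem_enum in_setD; case: (boolP (z \in U)) => //=.
  by move/(subsetP US) => ->.
have s_uniq : uniq s.
  rewrite /s !catA cats1 rcons_uniq -!catA memS vS /= !cat_uniq !enum_uniq /= andbT.
  apply/andP; split; apply/hasPn => z; rewrite ?mem_cat !mem_enum !in_setD.
    case/orP => [/andP[-> _] //|/andP[zU _]].
    by apply: contra zU; apply/subsetP.
  by move=> /andP[zU _]; rewrite negb_and zU orbT.
have s_size : size s = k.+1 by rewrite /s !catA size_cat -!catA sizeS addn1.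
pose h (i : Dsharp k t into) : D := nth v s i.
have lt_s (i : 'I_k.+1) : (i < size s)%N by rewrite s_size.
have h_inj : injective h.
  by move=> i j /eqP; rewrite nth_uniq // => /eqP/val_inj.
have hW (i : 'I_k.+1) : (nth v s i \in W) = (i < t./2)%N.
  by rewrite -mem_enum mem_nth_prefix // -cardE cardW.
have hU (i : 'I_k.+1) : (nth v s i \in U) = (i < uphalf t)%N.
  rewrite -memU -sizeWU.
  have := lt_s i; have := s_uniq; rewrite /s catA; exact: mem_nth_prefix.
have hS (i : 'I_k.+1) : (nth v s i \in S) = (i < k)%N.
  rewrite -memS -[X in _ = (_ < X)%N]sizeS.
  by have := lt_s i; have := s_uniq; rewrite /s !catA; apply: mem_nth_prefix.
have hv (i : 'I_k.+1) : (i < k)%N = false -> nth v s i = v.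
  move=> ik; have ->: (i : nat) = k by have := ltn_ord i; lia.
  by rewrite /s !catA nth_cat -!catA sizeS ltnn subnn.
apply: (iso_of_embedding h_inj) => [i j|z].
  rewrite /h /= /Dsharp_arc.
  have [ik|ik] := boolP (i < k)%N; have [jk|jk] := boolP (j < k)%N => /=.
  - by rewrite cliqueS ?hS // nth_uniq // s_size.
  - rewrite (hv j) ?(negbTE jk) //.
    have := erefl (nth v s i \in In); rewrite {1}inE hS ik /= => ->.
    by rewrite InE; case: (into); rewrite ?hU ?hW.
  - rewrite (hv i) ?(negbTE ik) //.
    have := erefl (nth v s j \in Out); rewrite {1}inE hS jk /= => ->.
    by rewrite OutE; case: (into); rewrite ?hU ?hW.
  - by rewrite (hv i) ?(hv j) ?(negbTE ik) ?(negbTE jk) // arc_irreflexive.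
move=> zn; have zs : z \in s.
  rewrite /s !catA mem_cat -!catA memS inE orbC; apply: contraNT zn.
  rewrite negb_or => /andP[zv zS]; apply/forallP => y; exact: iso_rest.
have lt_z : (index z s < k.+1)%N by rewrite -s_size index_mem.
by exists (Ordinal lt_z); rewrite /h /= nth_index.
Qed.

(** * The extremal digraph *)

Lemma sum_ord_lt (F : nzRingType) (k m : nat) : (m <= k)%N ->
  \sum_(i < k) (i < m)%:R = m%:R :> F.
Proof.
move=> mk; rewrite -natr_sum; congr _%:R.
rewrite -[RHS]card_ord -sum1_card -(big_mkord xpredT (fun=> 1%N)).
by rewrite (big_nat_widen _ _ k) // big_mkord [RHS]big_mkcond.
Qed.

(** The eigenvector is constant on the vertices of the clique that receive an arc from
    the added vertex, and on the others; the hypothesis on [rho] is the one equation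
    left after eliminating these values. Only the product and the minimum of the
    two numbers of arcs at the added vertex enter it, which is why the direction of
    the odd arc does not matter. *)
Lemma Dsharp_eigenvector (F : comNzRingType) (k t : nat) (into : bool) (rho : F) :
  (uphalf t <= k)%N ->
  (rho - k%:R + 1) * (rho * (rho + 1) - (t./2)%:R) = (t./2 * uphalf t)%:R ->
  let q := if into then t./2 else uphalf t in
  let f (i : Dsharp k t into) : F :=
    if (i < k)%N then q%:R + (rho - k%:R + 1) * (i < q)%:R
    else (rho - k%:R + 1) * (rho + 1) in
  forall j, \sum_i f i * (arc i j)%:R = rho * f j.
Proof.
move=> tk rhoE q f j.
have half_le : (t./2 <= uphalf t)%N by rewrite uphalf_half leq_addl.
pose p := if into then uphalf t else t./2.
have pk : (p <= k)%N by rewrite /p; case: (into); rewrite ?(leq_trans half_le).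
have qk : (q <= k)%N by rewrite /q; case: (into); rewrite ?(leq_trans half_le).
have fE (i : 'I_k) : f (widen_ord (leqnSn k) i) = q%:R + (rho - k%:R + 1) * (i < q)%:R.
  by rewrite /f /= ltn_ord.
have sumf : \sum_(i < k) f (widen_ord (leqnSn k) i) = q%:R * (rho + 1).
  rewrite (eq_bigr _ (fun i _ => fE i)) big_split /= -mulr_sumr sum_ord_lt //.
  by rewrite sumr_const card_ord -mulr_natr; ring.
rewrite big_ord_recr /=; have [jk|kj] := ltnP j k.
  rewrite {2}/f /= ltnn /Dsharp_arc /= ltnn jk.
  pose j' : 'I_k := Ordinal jk.
  have jE : j = widen_ord (leqnSn k) j' by apply: val_inj.
  rewrite (eq_bigr (fun i : 'I_k => f (widen_ord (leqnSn k) i) * (i != j')%:R)); last first.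
    by move=> i _; rewrite ltn_ord jE.
  have -> : \sum_(i < k) f (widen_ord (leqnSn k) i) * (i != j')%:R = q%:R * (rho + 1) - f j.
    rewrite -sumf [in RHS](bigD1 j') //= -jE [RHS]addrAC subrr add0r.
    rewrite [RHS]big_mkcond; apply: eq_bigr => i _.
    by case: (i != j'); rewrite ?mulr1 ?mulr0.
  rewrite jE fE -/q -[(j' : nat)]/(val j') /=; ring.
have jE : (j : nat) = k by apply/eqP; rewrite eqn_leq kj -ltnS ltn_ord.
rewrite {2}/Dsharp_arc /= ltnn jE ltnn mulr0 addr0.
rewrite (eq_bigr (fun i : 'I_k => q%:R * (i < p)%:R + (rho - k%:R + 1) * (i < t./2)%:R)).
  rewrite big_split /= -!mulr_sumr !sum_ord_lt //; last exact: leq_trans tk.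
  rewrite /f jE ltnn.
  have : q%:R * p%:R = (t./2 * uphalf t)%:R :> F.
    by rewrite -natrM /p /q; case: (into); rewrite // mulnC.
  by rewrite -rhoE => ->; ring.
move=> i _; rewrite fE /Dsharp_arc /= ltn_ord jE ltnn /= -/p mulrDl -mulrA.
congr (_ + _ * _); rewrite -natrM mulnb; congr (nat_of_bool _)%:R; rewrite /p /q.
by have := half_le; case: (into); case: ltnP; case: ltnP; lia.
Qed.

Lemma uphalf_le k t : (16 * t ^ 2 < k)%N -> (uphalf t <= k)%N.
Proof.
move=> k_gt; apply: leq_trans (ltnW k_gt); apply: (@leq_trans t).
  by rewrite -{2}(half_add_uphalf t) leq_addl.
by rewrite -{1}[t]expn1; nia.
Qed.

Section Extremal.
Context {R : realType} (k t : nat).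
Context (t_ge2 : (2 <= t)%N) (k_gt : (16 * t ^ 2 < k)%N).
Local Notation K := (k%:R : R).
Local Notation h := (t./2%:R : R).
Local Notation P := ((t./2 * uphalf t)%:R : R).

Lemma Dsharp_root : exists rho : R, K - 1 < rho /\
  (rho - K + 1) * (rho * (rho + 1) - h) = P.
Proof.
pose p : {poly R} := ('X - (K - 1)%:P) * ('X * ('X + 1) - h%:P) - P%:P.
have pE y : p.[y] = (y - K + 1) * (y * (y + 1) - h) - P.
  by rewrite /p !hornerE; ring.
have P_gt0 : 0 < P.
  by rewrite ltr0n uphalf_half; case: t t_ge2 => [|[|t']] //= _; rewrite addnS.
have [T2 K16 _] := size_bounds R t_ge2 k_gt.
have tE : t%:R = h + (uphalf t)%:R by rewrite -natrD half_add_uphalf.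
have h0 : 0 <= h by []. have H0 : 0 <= (uphalf t)%:R :> R by [].
have P_le : P + h <= K.
  have hH : 0 <= h * (uphalf t)%:R by rewrite mulr_ge0.
  rewrite natrM; rewrite tE in T2 K16.
  have := sqr_ge0 (h - (uphalf t)%:R).
  have h2 : 0 <= (h + (uphalf t)%:R) * (h + (uphalf t)%:R - 2) by apply: mulr_ge0; lra.
  lra.
have [y /andP[y1 y2] /rootP py] : exists2 y, K - 1 <= y <= K & root p y.
  apply: poly_ivt; first lra.
  rewrite !pE; apply/andP; split; first lra.
  have : 0 <= K * K by rewrite mulr_ge0. lra.
exists y; rewrite pE in py; split; last by apply/eqP; rewrite -subr_eq0 py.
rewrite lt_neqAle y1 andbT; apply/eqP => yE; rewrite -yE in py; lra.
Qed.

Context (rho : R) (rho_gt : K - 1 < rho).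
Context (rho_eq : (rho - K + 1) * (rho * (rho + 1) - h) = P).

Lemma rho_le_iso (D : digraph) (into : bool) :
  iso_up_to_isolated D (Dsharp k t into) -> rho <= spectral_radius R D.
Proof.
have rho_gt0 : 0 < rho.
  apply: le_lt_trans rho_gt; rewrite subr_ge0 ler1n; exact: leq_trans k_gt.
move=> /iso_eigenvector/(_ (Dsharp_eigenvector (uphalf_le k_gt) rho_eq)) [].
- by rewrite gt_eqF.
- exists ord_max; rewrite /= ltnn gt_eqF // mulr_gt0 //; last by rewrite addr_gt0.
  by have := rho_gt; lra.
by move=> f [[i fi] fz]; exact: eigenvector_le_spectral_radius (ltW rho_gt0) fi fz.
Qed.

(** The equality with [rho] also serves for [Dsharp] itself, of which the eigenvector
    alone shows only that its spectral radius is at least [rho]. *)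
Lemma extremal_iso (D : digraph) : num_arcs D = (k * (k - 1) + t)%N ->
    rho <= spectral_radius R D ->
  spectral_radius R D = rho /\
  exists into : bool, iso_up_to_isolated D (Dsharp k t into).
Proof.
rewrite num_arcsE => num rho_le.
have D_gt0 : (0 < #|D|)%N.
  rewrite lt0n; apply: contraTneq t_ge2 => D0.
  suff : arcs (@arc D) [set: D] [set: D] = 0%N by rewrite num; case: t => //; lia.
  by rewrite /arcs big1 // => i; have := card0_eq D0 i.
have [x [u [x01 xu x_sub]]] := spectral_radius_subvector R D_gt0.
have irr := @arc_irreflexive D.
have [S [cardS cliqueS X_ge]] := exists_heavy_clique irr x01 x_sub xu num t_ge2
  k_gt (lt_le_trans rho_gt rho_le).
have [-> [v [into [vS iso_rest cardIn cardOut nested]]]] :=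
  rigidity irr x01 x_sub num t_ge2 k_gt rho_gt rho_le rho_eq cardS cliqueS X_ge.
split=> //; exists into.
exact: iso_Dsharp (uphalf_le k_gt) cardS cliqueS vS iso_rest cardIn cardOut nested.
Qed.
End Extremal.

Unset Implicit Arguments.

Theorem theorem1p5 (R : realType) (k t e : nat)
    (t_ge2 : (2 <= t)%N) (t_le : (t <= 2 * k - 1)%N)
    (e_def : e = (k * (k - 1) + t)%N)
    (k_gt : (4 * t ^ 4 + 4 < k)%N) :
  [/\ forall into : bool,
        max_spectral_radius R e = spectral_radius R (Dsharp k t into),
      forall D : digraph, num_arcs D = e ->
        spectral_radius R D = max_spectral_radius R e ->
        exists into : bool, iso_up_to_isolated D (Dsharp k t into)
    & forall D : digraph, num_arcs D = e -> forall into : bool,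
        spectral_radius R D <= spectral_radius R (Dsharp k t into) /\
        (spectral_radius R D = spectral_radius R (Dsharp k t into) <->
         exists into' : bool, iso_up_to_isolated D (Dsharp k t into'))].
Proof.
have k_gt16 : (16 * t ^ 2 < k)%N.
  apply: leq_ltn_trans k_gt; apply: leq_trans (leq_addr _ _).
  rewrite (_ : 16 = 4 * 2 ^ 2)%N // -mulnA leq_mul2l /= -expnMn -[4%N]/(2 * 2)%N.
  by rewrite expnM leq_exp2r // expnS expn1 leq_mul2r t_ge2 orbT.
have [rho [rho_gt rho_eq]] := @Dsharp_root R k t t_ge2 k_gt16.
have core D := extremal_iso t_ge2 k_gt16 rho_gt rho_eq (D := D).
have num_Dsharp into : num_arcs (Dsharp k t into) = e by rewrite e_def num_arcs_Dsharp.
have bound D : num_arcs D = e -> spectral_radius R D <= rho.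
  rewrite e_def => num; rewrite leNgt; apply/negP => lt_rho.
  by have [h _] := core D num (ltW lt_rho); rewrite h ltxx in lt_rho.
have Dsharp_rho into : spectral_radius R (Dsharp k t into) = rho.
  apply/eqP; rewrite eq_le bound //=; apply: (rho_le_iso k_gt16 rho_gt rho_eq (into := into)).
  by exists id; split; first exact: (Bijective (g := id)).
have max_rho : max_spectral_radius R e = rho.
  apply/eqP; rewrite eq_le; apply/andP; split.
    apply: ge_sup; first by exists (spectral_radius R (Dsharp k t true)), (Dsharp k t true).
    by move=> _ [D num <-]; apply: bound.
  apply: ub_le_sup; last by exists (Dsharp k t true).
  by exists rho => _ [D num <-]; apply: bound.
split=> [into|D num|D num into]; rewrite ?Dsharp_rho ?max_rho //.
  by move=> DE; apply: (proj2 (core D _ _)); rewrite ?DE // -e_def.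
split; first exact: bound.
split=> [DE|[into' iso]].
  by apply: (proj2 (core D _ _)); rewrite ?DE // -e_def.
by apply/eqP; rewrite eq_le bound //=; apply: (rho_le_iso k_gt16 rho_gt rho_eq iso).
Qed.
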